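(* Suppose that $X$ is a locally compact subset of the Euclidean space $\mathbb{R}^{N}$ endowed with a positive Borel measure $\mu$, and that $E$ is a vector sublattice of $\mathcal{F}(X)$ that contains the following set of $2N+2$ test functions: $1,\ \pm\mathrm{pr}_{1},\ldots,\pm\mathrm{pr}_{N}$ and $\sum_{k=1}^{N}\mathrm{pr}_{k}^{2}$. (i) If $(T_{n})_{n}$ is a sequence of sublinear and monotone operators from $E$ into $E$ such that $$T_{n}(f)(x)\rightarrow f(x)\quad\text{a.e.}$$ for each of the $2N+2$ aforementioned test functions $f$, then this property extends to all nonnegative functions $f$ in $E\cap\mathcal{AC}_{b}(X)$. (ii) If, in addition, each operator $T_{n}$ is translatable, then $T_{n}(f)(x)\rightarrow f(x)$ a.e. for every $f\in E\cap\mathcal{AC}_{b}(X)$. Moreover, in both cases (i) and (ii) the family of test functions can be reduced to $1,\ -\mathrm{pr}_{1},\ldots,-\mathrm{pr}_{N}$ and $\sum_{k=1}^{N}\mathrm{pr}_{k}^{2}$ provided that $X$ is included in the positive cone of $\mathbb{R}^{N}$.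
   Context: $\mathcal{F}(X)$ is the vector lattice of all real-valued functions on $X$ with the pointwise ordering. $\mathcal{AC}_{b}(X)$ is the set of all bounded functions $f\in\mathcal{F}(X)$ that are continuous at almost every point of $X$. ''A.e.'' (almost everywhere) refers to $\mu$. $\mathrm{pr}_{k}$ denotes the $k$-th coordinate function $x=(x_1,\ldots,x_N)\mapsto x_k$ restricted to $X$, and $1$ is the constant function. The positive cone of $\mathbb{R}^N$ is the set of vectors with all coordinates $\geq 0$. An operator $T:E\to E$ (not assumed linear) is sublinear if $T(f+g)\leq T(f)+T(g)$ and $T(\alpha f)=\alpha T(f)$ for all $f,g\in E$, $\alpha\geq0$; monotone if $f\leq g$ implies $T(f)\leq T(g)$; translatable if $T(f+\alpha\cdot1)=T(f)+\alpha T(1)$ for all $f\in E$ and all $\alpha\geq0$. *)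

(* Defs.v *)
From HB Require Import structures.
From mathcomp Require Import all_boot all_order all_algebra.
From mathcomp Require Import all_classical all_reals all_analysis.

Set Implicit Arguments.
Unset Strict Implicit.
Unset Printing Implicit Defensive.

Import Order.TTheory GRing.Theory Num.Theory.
Import numFieldNormedType.Exports.

Local Open Scope classical_set_scope.
Local Open Scope ring_scope.

(** * Borel measures on a topological space

The measurable types of the library are pointed, so a possibly empty subspace
of R^N cannot be made into one.  The definitions below are those of
[measure] and [almost_everywhere] for the Borel sigma-algebra, without the
base point; [is_borel_measureP] and [borel_aeP] check that they agree with the
library's on pointed spaces. *)

Definition borel {T : topologicalType} : set (set T) := <<s @open T >>.

(* [mu] is only meaningful on Borel sets, its other values are unconstrained. *)
Definition is_borel_measure {R : realType} {T : topologicalType}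
    (mu : set T -> \bar R) : Prop :=
  [/\ mu set0 = 0%E,
      forall A, borel A -> (0 <= mu A)%E
    & forall F : (set T)^nat, (forall i, borel (F i)) -> trivIset setT F ->
        (fun n => \sum_(0 <= i < n) mu (F i))%E @ \oo --> mu (\bigcup_n F n)].

Definition borel_ae {R : realType} {T : topologicalType}
    (mu : set T -> \bar R) : set_system T :=
  fun P => exists A, [/\ borel A, mu A = 0%E & ~` P `<=` A].

Section agreement_with_the_library.
Context {R : realType} {T : ptopologicalType}.

Let B := g_sigma_algebraType (@open T).

Lemma is_borel_measureP (mu : set T -> \bar R) :
  is_borel_measure mu <->
  exists nu : {measure set B -> \bar R}, forall A, borel A -> mu A = nu A.
Proof.
split=> [[mu0 mu_ge0 muU]|[nu muE]].
  pose m (A : set B) : \bar R := if `[< borel A >] then mu A else 0%E.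
  have mE A : borel A -> m A = mu A by move=> bA; rewrite /m asboolT.
  have m0 : m set0 = 0%E by rewrite mE ?mu0//; exact: sigma_algebra0.
  have m_ge0 A : (0 <= m A)%E.
    by rewrite /m; case: asboolP => // /mu_ge0.
  have mU : semi_sigma_additive m.
    move=> F bF tF bUF; rewrite mE//.
    rewrite (_ : (fun n => _) = fun n => \sum_(0 <= i < n) mu (F i))%E.
      exact: muU.
    by apply/funext => n; apply: eq_bigr => i _; exact: mE (bF i).
  pose mM := isMeasure.Build _ _ _ m m0 m_ge0 mU.
  pose nu : {measure set B -> \bar R} := HB.pack m mM.
  by exists nu => A /mE.
split=> [|A bA|F bF tF].
- by rewrite muE ?measure0//; exact: sigma_algebra0.
- by rewrite muE.
- have bUF : borel (\bigcup_n F n) by exact: sigma_algebra_bigcup.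
  rewrite muE// (_ : (fun n => _) = fun n => \sum_(0 <= i < n) nu (F i))%E.
    exact: (@measure_semi_sigma_additive _ B R nu F bF tF bUF).
  by apply/funext => n; apply: eq_bigr => i _; exact: muE (bF i).
Qed.

Lemma borel_aeP (nu : {measure set B -> \bar R}) (P : set T) :
  (\forall x \near borel_ae (nu : set T -> \bar R), P x) <->
  {ae nu, forall x, P x}.
Proof. by split=> -[A [? ? ?]]; exists A. Qed.

End agreement_with_the_library.

(** * Functions on a subset of R^N

For [X : set 'rV[R]_N], the functions on [X] are the functions on the subtype
[X], which carries the subspace topology.  The topology of ['rV[R]_N] is that of
the max norm, i.e. the Euclidean one. *)

Definition positive_cone {R : realType} {N : nat} : set 'rV[R]_N :=
  [set x : 'rV[R]_N | forall k, 0 <= x ord0 k].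

Section functions_on_X.
Context {R : realType} {N : nat} {X : set 'rV[R]_N}.

Definition pr (k : 'I_N) : X -> R := fun x => set_val x ord0 k.

Definition sum_pr_sq : X -> R := fun x => \sum_(k < N) pr k x ^+ 2.

Definition test_functions : set (X -> R) :=
  [set cst 1] `|` range pr `|` range (fun k => - pr k) `|` [set sum_pr_sq].

Definition reduced_test_functions : set (X -> R) :=
  [set cst 1] `|` range (fun k => - pr k) `|` [set sum_pr_sq].

Definition vector_sublattice (E : set (X -> R)) : Prop :=
  [/\ E 0,
      forall f g, E f -> E g -> E (f + g),
      forall (a : R) f, E f -> E (a *: f)
    & forall f g, E f -> E g -> E (f \max g) /\ E (f \min g)].

Definition AC_b (mu : set X -> \bar R) : set (X -> R) :=
  [set f : X -> R | [bounded f x | x in [set: X]] /\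
           \forall x \near borel_ae mu, {for x, continuous f}].

Variable E : set (X -> R).
Implicit Type T : {fun E >-> E}.

Definition sublinear T : Prop :=
  (forall f g, E f -> E g -> forall x, T (f + g) x <= T f x + T g x) /\
  (forall (a : R) f, 0 <= a -> E f -> T (a *: f) = a *: T f).

Definition monotone_op T : Prop :=
  forall f g, E f -> E g -> (forall x, f x <= g x) ->
    forall x, T f x <= T g x.

Definition translatable T : Prop :=
  forall f (a : R), E f -> 0 <= a ->
    T (f + a *: cst 1) = T f + a *: T (cst 1).

Definition ae_cvg_to_id (mu : set X -> \bar R) (T : nat -> {fun E >-> E})
    (f : X -> R) : Prop :=
  \forall x \near borel_ae mu, T n f x @[n --> \oo] --> f x.

End functions_on_X.

(* Main.v *)
Require Import Defs.
From mathcomp Require Import all_boot all_order all_algebra.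
From mathcomp Require Import all_classical all_reals all_analysis.
From mathcomp Require Import ring lra.
Import Order.TTheory GRing.Theory Num.Theory.
Import numFieldNormedType.Exports.
Local Open Scope classical_set_scope.
Local Open Scope ring_scope.

(** This is a Korovkin theorem, and its content is a statement at one point.
Fix a point [x] at which [f] is continuous and at which the convergence holds
for the test functions.  A bounded [f] satisfies, for every [e > 0] and a
suitable constant [C],
[[
    |f y - f x| <= e + C * dist_sq x y    for all y,
]]
where [dist_sq x] is the squared distance to [x] ([dist_sq_modulus]): the first
summand takes care of the points near [x], the second one of the others.  Hence
[[
    f <= (f x + e) 1 + C dist_sq x    and    (f x) 1 <= f + e 1 + C dist_sq x,
]]
and monotone sublinear operators preserve both inequalities, provided that
only nonnegative multiples are involved; this is where [0 <= f x] is needed.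
Evaluating at [x] gives the claim as soon as the limit superior of
[T n (dist_sq x) x] is at most [dist_sq x x = 0] ([korovkin_at]).

Expanding the squares, [dist_sq x] is [sum_pr_sq], plus the constant
[sum_pr_sq x], plus twice the sum of the functions [(- x_k) *: pr k]
([dist_sqE]).  The functions [g] for which the limit superior of [T n g x] is
at most [g x] form a convex cone, so that it remains to put [(- x_k) *: pr k]
into it.  It is a nonnegative multiple of [- pr k] or of [pr k] according to the
sign of [x_k], and on the positive cone only [- pr k] occurs.

If the operators are translatable, a bounded [f] is made nonnegative by adding
a constant.  Finally, only finitely many conditions that hold almost everywhere
have been imposed on [x], and finitely many null sets have a null union
([borel_ae_filter]). *)

(** * Borel null sets *)

Section borel_ae_filter.
Context {R : realType} {T : topologicalType}.
Implicit Types A B : set T.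

Lemma borelC A : borel A -> borel (~` A).
Proof. by rewrite -setTD; exact: sigma_algebraCD. Qed.

Lemma borelU A B : borel A -> borel B -> borel (A `|` B).
Proof.
move=> bA bB; rewrite -bigcup2E; apply: sigma_algebra_bigcup => -[|[|n]] //=.
exact: sigma_algebra0.
Qed.

Lemma borelD A B : borel A -> borel B -> borel (A `\` B).
Proof.
move=> bA bB; rewrite setDE -[X in borel X]setCK setCI setCK.
by apply: borelC; apply: borelU => //; exact: borelC.
Qed.

Context {mu : set T -> \bar R} (mu_borel : is_borel_measure mu).

Lemma borel_measureU A B : borel A -> borel B -> A `&` B = set0 ->
  mu (A `|` B) = (mu A + mu B)%E.
Proof.
move=> bA bB AB0; have [mu0 _ muU] := mu_borel.
have b2 i : borel (bigcup2 A B i).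
  by case: i => [|[|n]] //=; exact: sigma_algebra0.
have t2 : trivIset setT (bigcup2 A B) by rewrite -trivIset_bigcup2.
have := muU _ b2 t2; rewrite bigcup2E => cvgU.
apply: (cvg_unique _ cvgU); first exact: ereal_hausdorff.
apply: cvg_near_cst; exists 2%N => // -[|[|n]] //= _.
by rewrite !big_nat_recl//= addeA big1 ?adde0// => i _.
Qed.

(** Apply additivity to [A] and [B `\` A]; the latter is null because it is a
Borel part of [B]. *)
Lemma borel_null_setU A B : borel A -> borel B ->
  mu A = 0%E -> mu B = 0%E -> mu (A `|` B) = 0%E.
Proof.
move=> bA bB muA muB; have [_ mu_ge0 _] := mu_borel.
have bBA : borel (B `\` A) by exact: borelD.
have bBBA : borel (B `\` (B `\` A)) by exact: borelD.
have BA_le0 : (mu (B `\` A) <= 0)%E.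
  rewrite -muB -[X in (_ <= mu X)%E](@setDUK _ (B `\` A)); last by move=> ? [].
  by rewrite borel_measureU ?setDIK// leeDl// mu_ge0.
have BA0 : mu (B `\` A) = 0%E by apply/le_anti; rewrite BA_le0 mu_ge0.
have -> : A `|` B = A `|` (B `\` A).
  by rewrite -[LHS](setDUK (@subsetUl _ A B)) setDUl setDv set0U.
by rewrite borel_measureU ?setDIK// muA BA0 adde0.
Qed.

Lemma borel_ae_filter : Filter (borel_ae mu).
Proof.
have [mu0 _ _] := mu_borel; split.
- by exists set0; split; [exact: sigma_algebra0|exact: mu0|rewrite setCT].
- move=> P Q [A [bA A0 PA]] [B [bB B0 QB]]; exists (A `|` B); split.
  + exact: borelU.
  + exact: borel_null_setU.
  + by rewrite setCI; exact: setUSS.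
- move=> P Q PQ [A [bA A0 PA]]; exists A; split=> // y.
  by move=> /(contra_not (PQ y)) /PA.
Qed.

End borel_ae_filter.

(** * The squared distance to a point *)

Section korovkin.
Context {R : realType} {N : nat} {X : set 'rV[R]_N}.
Implicit Types (f g h D : X -> R) (x y : X).

Let scaleE (a : R) g y : (a *: g) y = a * g y. Proof. by []. Qed.

Let addE g h y : (g + h) y = g y + h y. Proof. by []. Qed.

Let cst1E y : cst 1 y = 1 :> R. Proof. by []. Qed.

Let lcE := (scaleE, addE, cst1E).

Definition dist_sq x : X -> R := fun y => \sum_(k < N) (pr k y - pr k x) ^+ 2.

Lemma dist_sq_ge0 x y : 0 <= dist_sq x y.
Proof. by apply: sumr_ge0 => k _; exact: sqr_ge0. Qed.

Lemma dist_sqxx x : dist_sq x x = 0.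
Proof. by apply: big1 => k _; rewrite subrr expr0n. Qed.

(** The coefficients of the cross terms are grouped as [(- pr k x) *: pr k],
whose sign decides which of the functions [pr k] and [- pr k] is used; the two
remaining coefficients are nonnegative. *)
Lemma dist_sqE x : dist_sq x =
  sum_pr_sq + \sum_(k < N) 2 *: ((- pr k x) *: pr k) + sum_pr_sq x *: cst 1.
Proof.
apply/funext => y; rewrite /dist_sq !lcE fct_sumE mulr1.
rewrite /sum_pr_sq -!big_split /=; apply: eq_bigr => k _.
by rewrite !lcE; ring.
Qed.

(** Outside a ball of radius [d] for the max norm, one coordinate already
contributes [d ^+ 2]. *)
Lemma dist_sq_far x (P : set X) : nbhs x P ->
  exists2 d : R, 0 < d & forall y, ~ P y -> d <= dist_sq x y.
Proof.
move=> /nbhs_ballP[d /= d0 dP]; exists (d ^+ 2); first exact: exprn_gt0.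
move=> y nPy; rewrite leNgt; apply/negP => Dy; apply: nPy; apply: dP.
suff : ball (set_val x) d (set_val y) by [].
split=> // i k; rewrite ord1 -ball_normE/= distrC.
rewrite -ltr_sqr ?nnegrE ?normr_ge0 ?(ltW d0)// real_normK ?num_real//.
apply: le_lt_trans Dy.
by rewrite /dist_sq (bigD1 k)//= lerDl sumr_ge0// => j _; exact: sqr_ge0.
Qed.

Lemma bounded_ge0 f : [bounded f y | y in [set: X]] ->
  exists2 M, 0 <= M & forall y, `|f y| <= M.
Proof.
move=> [M [_ Mf]]; exists (`|M| + 1); first by rewrite addr_ge0.
by move=> y; apply: Mf => //; rewrite (le_lt_trans (ler_norm M))// ltrDl.
Qed.

(** Near [x] the continuity of [f] gives [e]; away from [x] the left-hand side is
at most [2 * M], with [M] a bound of [f], whereas [dist_sq x] is bounded below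
by some [d > 0], so that [C := 2 * M / d] works. *)
Lemma dist_sq_modulus f x e : [bounded f y | y in [set: X]] ->
  {for x, continuous f} -> 0 < e ->
  exists2 C, 0 <= C & forall y, `|f y - f x| <= e + C * dist_sq x y.
Proof.
move=> /(bounded_ge0 f)[M M0 Mf] fx e0.
move/cvgrPdist_le : fx => /(_ _ e0) /dist_sq_far[d d0 fd].
have C0 : 0 <= 2 * M / d by rewrite divr_ge0 ?mulr_ge0// ltW.
exists (2 * M / d) => // y.
case: (leP `|f x - f y| e) => [fxy|/lt_geF fxy].
  by rewrite distrC (le_trans fxy)// lerDl mulr_ge0// dist_sq_ge0.
have dD : d <= dist_sq x y by apply: fd; rewrite fxy.
rewrite (le_trans (ler_normB _ _))//.
rewrite (@le_trans _ _ (2 * M / d * d))//.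
  by rewrite divfK ?gt_eqF//; have := Mf x; have := Mf y; lra.
by rewrite ler_wpDl ?(ltW e0)// ler_wpM2l.
Qed.

(** * Convergence at a point *)

Context {E : set (X -> R)} (Evl : vector_sublattice E).
Context {T : nat -> {fun E >-> E}}.
Context (T_op : forall n, sublinear (T n) /\ monotone_op (T n)).

Let T_sublin n : sublinear (T n). Proof. by have [] := T_op n. Qed.

Let T_mono n : monotone_op (T n). Proof. by have [] := T_op n. Qed.

(** The limit superior of [T n g x] is at most [g x].  Contrary to convergence,
this is stable under sums when the operators are only subadditive. *)
Definition limsup_le x : set (X -> R) :=
  [set g | E g /\ forall e, 0 < e -> \forall n \near \oo, T n g x <= g x + e].

Lemma limsup_le_cvg x g : E g -> T n g x @[n --> \oo] --> g x ->
  limsup_le x g.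
Proof.
move=> Eg /cvgrPdist_le gx; split=> // e /gx.
by apply: filterS => n; rewrite ler_distlC => /andP[].
Qed.

Lemma limsup_leD x g h : limsup_le x g -> limsup_le x h ->
  limsup_le x (g + h).
Proof.
move=> [Eg gx] [Eh hx]; have [_ ED _ _] := Evl; split=> [|e e0].
  exact: ED.
have e2 : 0 < e / 2 by rewrite divr_gt0.
near=> n; have [TD _] := T_sublin n; rewrite (le_trans (TD _ _ Eg Eh x))//.
have Tg : T n g x <= g x + e / 2 by near: n; exact: gx.
have Th : T n h x <= h x + e / 2 by near: n; exact: hx.
by rewrite lcE; lra.
Unshelve. all: by end_near. Qed.

Lemma limsup_leZ x (a : R) g : 0 <= a -> limsup_le x g ->
  limsup_le x (a *: g).
Proof.
move=> a0 [Eg gx]; have [_ _ EZ _] := Evl; split=> [|e e0]; first exact: EZ.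
have a1 : 0 < a + 1 by rewrite ltr_wpDl.
have : \forall n \near \oo, T n g x <= g x + e / (a + 1).
  by apply: gx; rewrite divr_gt0.
apply: filterS => n Tg; have [_ TZ] := T_sublin n; rewrite TZ// !lcE.
rewrite (le_trans (ler_wpM2l a0 Tg))// mulrDr lerD2l.
by rewrite mulrA ler_pdivrMr//; nra.
Qed.

Lemma limsup_le_sum x (F : 'I_N -> X -> R) :
  (forall k, limsup_le x (F k)) -> limsup_le x (\sum_k F k).
Proof.
move=> Fx; apply: big_ind => //; last exact: limsup_leD.
have [E0 _ _ _] := Evl.
split=> // e e0; apply: nearW => n; have [_ TZ] := T_sublin n.
have := TZ 0 0 (lexx _) E0; rewrite scale0r => ->.
by rewrite scale0r add0r ltW.
Qed.

(** [D] is a peak function at [x]: it dominates the oscillation of [f] up to any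
[e], and its images are asymptotically nonpositive at [x].  Both [f] and the
constant [f x] are then squeezed between combinations with nonnegative
coefficients. *)
Lemma korovkin_at x f D : E (cst 1) -> T n (cst 1) x @[n --> \oo] --> (1 : R) ->
  limsup_le x D -> D x = 0 ->
  (forall e, 0 < e -> exists2 C, 0 <= C & forall y, `|f y - f x| <= e + C * D y) ->
  E f -> 0 <= f x ->
  T n f x @[n --> \oo] --> f x.
Proof.
move=> E1 T1 Dx Dx0 fD Ef fx0; have [_ ED EZ _] := Evl.
apply/cvgrPdist_le => e e0.
have e4 : 0 < e / 4 by rewrite divr_gt0.
have [C C0 fC] := fD _ e4.
(* A quarter of [e] comes from the modulus of [f], another one from the limit
   superior, and in the lower bound a third one from [T n 1]. *)
have maj (a : R) : 0 <= a -> limsup_le x (a *: cst 1 + C *: D).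
  move=> a0; apply: limsup_leD; apply: limsup_leZ => //.
  exact: limsup_le_cvg.
have [Eg gx] := maj (f x + e / 4) (addr_ge0 fx0 (ltW e4)).
have [Eh hx] := maj (e / 4) (ltW e4).
have {}T1 : f x * T n (cst 1) x @[n --> \oo] --> f x.
  by rewrite -[X in _ --> X]mulr1; apply: cvgM => //; exact: cvg_cst.
have {}T1 : \forall n \near \oo, f x - e / 4 <= f x * T n (cst 1) x.
  move/cvgrPdist_le : T1 => /(_ _ e4).
  by apply: filterS => n; rewrite ler_distlC => /andP[].
near=> n.
have [TD TZ] := T_sublin n.
have fg : T n f x <= T n ((f x + e / 4) *: cst 1 + C *: D) x.
  apply: T_mono => // y; rewrite !lcE.
  by have := fC y; rewrite ler_distl => /andP[]; lra.
have ffh : f x * T n (cst 1) x <= T n (f + (e / 4 *: cst 1 + C *: D)) x.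
  have := TZ (f x) _ fx0 E1; move/(congr1 (fun u : X -> R => u x)).
  rewrite lcE => <-; apply: T_mono => //; [exact: EZ|exact: ED|].
  by move=> y; rewrite !lcE; have := fC y; rewrite ler_distl => /andP[]; lra.
have Tg : T n ((f x + e / 4) *: cst 1 + C *: D) x <= f x + e / 4 + e / 4.
  have <- : ((f x + e / 4) *: cst 1 + C *: D) x + e / 4 = f x + e / 4 + e / 4.
    by rewrite !lcE Dx0; lra.
  by near: n; exact: gx.
have Th : T n ((e / 4) *: cst 1 + C *: D) x <= e / 4 + e / 4.
  have <- : ((e / 4) *: cst 1 + C *: D) x + e / 4 = e / 4 + e / 4.
    by rewrite !lcE Dx0; lra.
  by near: n; exact: hx.
have Tfh := TD _ _ Ef Eh x.
have T1n : f x - e / 4 <= f x * T n (cst 1) x by near: n; exact: T1.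
by rewrite ler_distlC; apply/andP; split; lra.
Unshelve. all: by end_near. Qed.

(** * Almost everywhere convergence *)

Context {mu : set X -> \bar R} (mu_borel : is_borel_measure mu).
Context (E1 : E (cst 1)) (T1 : ae_cvg_to_id mu T (cst 1)).
Context (ES : E sum_pr_sq) (TS : ae_cvg_to_id mu T sum_pr_sq).
Context (Tpr : forall k,
  \forall x \near borel_ae mu, limsup_le x (- pr k x *: pr k)).

Lemma ae_limsup_le_dist_sq :
  \forall x \near borel_ae mu, limsup_le x (dist_sq x).
Proof.
have Fmu := borel_ae_filter mu_borel.
apply: filterS3 T1 TS (filter_forall Fmu Tpr) => x T1x TSx Tprx.
rewrite dist_sqE; apply: limsup_leD; first apply: limsup_leD.
- exact: limsup_le_cvg.
- by apply: limsup_le_sum => k; exact: limsup_leZ.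
- apply: limsup_leZ; last exact: limsup_le_cvg.
  by apply: sumr_ge0 => k _; exact: sqr_ge0.
Qed.

Lemma korovkin_ae f : (E `&` AC_b mu) f -> (forall x, 0 <= f x) ->
  ae_cvg_to_id mu T f.
Proof.
move=> [Ef [fbnd fcont]] f_ge0; have Fmu := borel_ae_filter mu_borel.
apply: filterS3 T1 ae_limsup_le_dist_sq fcont => x T1x TDx fx.
apply: (korovkin_at x f (dist_sq x)) => //; first exact: dist_sqxx.
by move=> e e0; exact: dist_sq_modulus.
Qed.

(** If [M] bounds [f], then [f + M *: cst 1] is nonnegative, and translatability
cancels the constant. *)
Lemma korovkin_ae_translatable f : (forall n, translatable (T n)) ->
  (E `&` AC_b mu) f -> ae_cvg_to_id mu T f.
Proof.
move=> T_trans [Ef [fbnd fcont]]; have Fmu := borel_ae_filter mu_borel.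
have [_ ED EZ _] := Evl.
have [M M0 fM] := bounded_ge0 _ fbnd.
have EM : E (M *: cst 1) by exact: EZ.
have TfM : ae_cvg_to_id mu T (f + M *: cst 1).
  apply: korovkin_ae => [|x].
    split; first exact: ED.
    split.
      exists (2 * M); split; first exact: num_real.
      move=> r Mr x _; rewrite /= !lcE mulr1 (le_trans (ler_normD _ _))//.
      by rewrite (ger0_norm M0); have := fM x; lra.
    apply: filterS fcont => x fx; apply: continuousD; first exact: fx.
    exact: cst_continuous.
  by rewrite !lcE; have := fM x; rewrite ler_norml => /andP[]; lra.
apply: filterS2 T1 TfM => x T1x TfMx.
have -> : (fun n => T n f x) =
    (fun n => T n (f + M *: cst 1) x - M * T n (cst 1) x).
  by apply/funext => n; rewrite T_trans// !lcE addrK.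
have -> : f x = (f + M *: cst 1) x - M * cst 1 x by rewrite !lcE addrK.
by apply: cvgB => //; apply: cvgM => //; exact: cvg_cst.
Qed.

(** The assumption on the functions [(- pr k x) *: pr k] is what the full and the
reduced family of test functions have in common. *)
Lemma korovkin_of_coordinates :
  (forall f, (E `&` AC_b mu) f -> (forall x, 0 <= f x) ->
     ae_cvg_to_id mu T f) /\
  ((forall n, translatable (T n)) ->
     forall f, (E `&` AC_b mu) f -> ae_cvg_to_id mu T f).
Proof.
split=> [f|T_trans f]; first exact: korovkin_ae.
exact: korovkin_ae_translatable.
Qed.

End korovkin.

Theorem theorem2 (R : realType) (N : nat) (X : set 'rV[R]_N)
    (mu : set X -> \bar R) (E : set (X -> R)) :
  locally_compact [set: X] ->
  is_borel_measure mu ->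
  vector_sublattice E ->
  (test_functions `<=` E ->
   forall T : nat -> {fun E >-> E},
     (forall n, sublinear (T n) /\ monotone_op (T n)) ->
     (forall f, test_functions f -> ae_cvg_to_id mu T f) ->
     (forall f, (E `&` AC_b mu) f -> (forall x, 0 <= f x) ->
        ae_cvg_to_id mu T f) /\
     ((forall n, translatable (T n)) ->
      forall f, (E `&` AC_b mu) f -> ae_cvg_to_id mu T f)) /\
  (X `<=` positive_cone ->
   reduced_test_functions `<=` E ->
   forall T : nat -> {fun E >-> E},
     (forall n, sublinear (T n) /\ monotone_op (T n)) ->
     (forall f, reduced_test_functions f -> ae_cvg_to_id mu T f) ->
     (forall f, (E `&` AC_b mu) f -> (forall x, 0 <= f x) ->
        ae_cvg_to_id mu T f) /\
     ((forall n, translatable (T n)) ->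
      forall f, (E `&` AC_b mu) f -> ae_cvg_to_id mu T f)).
Proof.
move=> _ mu_borel Evl; have Fmu := borel_ae_filter mu_borel.
split=> [testE T T_op T_test|X_pos testE T T_op T_test].
- have test1 : @test_functions R N X (cst 1) by left; left; left.
  have testS : @test_functions R N X sum_pr_sq by right.
  have test_pr k : @test_functions R N X (pr k) by left; left; right; exists k.
  have test_prN k : @test_functions R N X (- pr k) by left; right; exists k.
  apply: korovkin_of_coordinates (T_test _ test1) _ (T_test _ testS) _ => //;
    [exact: testE|exact: testE|] => k.
  apply: filterS2 (T_test _ (test_pr k)) (T_test _ (test_prN k)) => x Tx TNx.
  have [pr_ge0|/ltW pr_le0] := leP 0 (pr k x).
    rewrite scaleNr -scalerN; apply: limsup_leZ => //.
    by apply: limsup_le_cvg => //; exact: testE.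
  apply: limsup_leZ; rewrite ?oppr_ge0//.
  by apply: limsup_le_cvg => //; exact: testE.
- have test1 : @reduced_test_functions R N X (cst 1) by left; left.
  have testS : @reduced_test_functions R N X sum_pr_sq by right.
  have test_prN k : @reduced_test_functions R N X (- pr k).
    by left; right; exists k.
  apply: korovkin_of_coordinates (T_test _ test1) _ (T_test _ testS) _ => //;
    [exact: testE|exact: testE|] => k.
  apply: filterS (T_test _ (test_prN k)) => x TNx.
  rewrite scaleNr -scalerN; apply: limsup_leZ => //.
  + by apply: X_pos; exact: set_valP.
  + by apply: limsup_le_cvg => //; exact: testE.
Qed.
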